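(* Let $f:\mathcal Y\to C$ be a uniformized type II Kulikov degeneration of relative dimension $\delta\in\{1,2\}$ with $2N$ components. Then the dual complex $\Delta(K^2_{\mathcal Y/C})$ associated to $K^2_{\mathcal Y/C}$ is PL-homeomorphic to a standard $2$-simplex; in particular, it is $2$-dimensional.
   Context: **Geometric background.** $f:\mathcal Y\to C$ is a projective family over a smooth pointed curve $(C,0)$ over an algebraically closed field of characteristic $0$, an abelian scheme of relative dimension $\delta$ over $C\setminus 0$, with $\mathcal Y$ regular, $\omega_{\mathcal Y/C}$ trivial and $\mathcal Y_0$ a reduced strict normal crossings divisor without triple intersections, which is a cycle of $2N$ components ($N\ge1$), constructed by Mumford's uniformization (Faltings–Chai, K\''unnemann). $\mathcal Y[b]\to C[b]$ is the $b$-th expanded degeneration of J. Li, whose fibre over the origin is a cycle of components $G^b_j$, $j\in\mathbb Z/2N(b+1)$, and $K^2_{\mathcal Y/C}$ is the degeneration of the family $\mathrm{Kum}^2(\mathcal Y\setminus\mathcal Y_0)$ obtained as its closure in the GIT quotient $I^3_{\mathcal Y/C}$ of the stable locus of $\mathrm{Hilb}^3(\mathcal Y[3]/C[3])$ by the torus $\mathbb G_m^3$. The fibre $(K^2_{\mathcal Y/C})_0$ is stratified by smooth irreducible strata indexed by tuples $\mathbf m=(m_j)_{j\in\mathbb Z/2N(b+1)}$, $0\le b\le3$, where $m_j$ is the number of the three points on the component $G^b_j$. The dual complex encodes which strata occur and which strata lie in the closure of which; it depends only on $N$ and is given by the following combinatorial definition (here $n=3$). **Labels of strata.** For a nonempty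 $I\subset\{1,\dots,n+1\}$, $\varepsilon\in\{\pm1\}^n$ and $\tau\in(\mathbb Z/N)^n$ put $b=|I|-1$, $c_I(i)=\#\{a\in I:a\le i\}$, and let $\mathbf m(I,\varepsilon,\tau)$ be the tuple with entries $m_j=\#\{i\in\{1,\dots,n\}:2\tau_i(b+1)+\varepsilon_ic_I(i)\equiv j\bmod 2N(b+1)\}$, $j\in\mathbb Z/2N(b+1)$. Put $s_i=\varepsilon_i+\varepsilon_{i+1}+\dots+\varepsilon_n$ for $1\le i\le n$ and $s_{n+1}=0$ (the points $(n+1-i,s_i)$, $i\in I$, form the ''line chart'' of the stratum). For $k\in\mathbb Z$ with $\tau_1+\dots+\tau_n+k\equiv0\bmod N$, the data $(I,\varepsilon,\tau,k)$ are called admissible if either $\min_{i\in I}s_i<2k<\max_{i\in I}s_i$ or $s_i=2k$ for all $i\in I$. (The stratum $\mathbf m(I,\varepsilon,\tau)$ occurs in $(K^{n-1}_{\mathcal Y/C})_0$ iff $(I,\varepsilon,\tau,k)$ is admissible for some $k$; removing elements from $I$, keeping admissibility, corresponds to passing to a stratum containing the given one in its closure.) **The dual complex.** For each triple $(\varepsilon,\tau,k)$ such that $(\{1,\dots,n+1\},\varepsilon,\tau,k)$ is admissible (a deepest stratum; for $n=3$ the integer $k$ is determined by $\varepsilon$), let $$P(\varepsilon,\tau,k)=\Big\{z\in\mathbb R_{\ge0}^{n+1}:\ \sum_iz_i=1,\ \sum_{s_i>2k}z_i=\sum_{s_i<2k}z_i\Big\}.$$ This is a convex polytope whose nonempty faces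 are the $F_I=P(\varepsilon,\tau,k)\cap\{z_i=0\text{ for }i\notin I\}$ with $(I,\varepsilon,\tau,k)$ admissible; $F_I$ corresponds to the stratum $\mathbf m(I,\varepsilon,\tau)$. $\Delta(K^{n-1}_{\mathcal Y/C})$ is the quotient of the disjoint union of all $P(\varepsilon,\tau,k)$ by identifying faces corresponding to the same stratum: a point $z$ of $P(\varepsilon,\tau,k)$ and the point $z$ (same coordinates) of $P(\varepsilon',\tau',k')$ are identified whenever, with $I=\{i:z_i\ne0\}$, one has $\mathbf m(I,\varepsilon,\tau)=\mathbf m(I,\varepsilon',\tau')$. *)

(* Defs.v *)
From HB Require Import structures.
From mathcomp Require Import all_boot all_order all_algebra.
From mathcomp Require Import all_classical all_reals all_analysis.

Set Implicit Arguments.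
Unset Strict Implicit.
Unset Printing Implicit Defensive.

Import Order.TTheory GRing.Theory Num.Theory.
Import numFieldNormedType.Exports.

Local Open Scope ring_scope.
Local Open Scope quotient_scope.

(* The indices i in {1, ..., n + 1} are shifted to i : 'I_n.+1, and those
   in {1, ..., n} to i : 'I_n. *)

Section Labels.
Variables n N : nat.

(* eps i = true encodes the sign -1; tau i : 'I_N is the representative in
   [0, N) of a residue class modulo N (N = 1 included). *)
Definition label : Type :=
  ({ffun 'I_n -> bool} * {ffun 'I_n -> 'I_N} * int)%type.

Definition eps (x : label) (i : 'I_n) : int := (-1) ^+ x.1.1 i.
Definition tau (x : label) (i : 'I_n) : int := (x.1.2 i : nat)%:Z.
Definition kk (x : label) : int := x.2.

Definition height (x : label) (i : 'I_n.+1) : int :=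
  \sum_(j < n | (i <= j)%N) eps x j.

Definition card_below (I : {set 'I_n.+1}) (i : 'I_n) : nat :=
  #|[set a in I | (a <= i)%N]%SET|.

Definition mtuple (I : {set 'I_n.+1}) (x : label) :
    {ffun 'I_(2 * N * (#|I|.-1).+1) -> nat} :=
  let b := #|I|.-1 in
  [ffun j : 'I_(2 * N * b.+1) => #|[set i : 'I_n |
     (2 * tau x i * (b.+1)%:Z + eps x i * (card_below I i)%:Z
        == (j : nat)%:Z %[mod (2 * N * b.+1)%N%:Z])%Z]%SET|].

Definition admissible (I : {set 'I_n.+1}) (x : label) : bool :=
  [&& I != finset.set0,
      (N%:Z %| (\sum_i tau x i) + kk x)%Z &
      [exists i in I, height x i < 2 * kk x]
        && [exists i in I, 2 * kk x < height x i]
      || [forall i in I, height x i == 2 * kk x]].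

Definition deepest : Type := {x : label | admissible [set: 'I_n.+1]%SET x}.

HB.instance Definition _ := Choice.on deepest.

End Labels.

Local Open Scope classical_set_scope.

Section PL.
Variable R : realType.

Definition polyhedron (d : nat) (S : set 'rV[R]_d) : Prop :=
  exists (m : nat) (A : 'M[R]_(d, m)) (b : 'rV[R]_m),
    S = [set z | forall j, (z *m A) 0 j <= b 0 j].

Definition dim_ge (e : nat) (A : set 'rV[R]_e) (d : nat) : Prop :=
  exists p : 'I_d.+1 -> 'rV[R]_e, (forall i, A (p i)) /\
    row_free (\matrix_(i < d) (p (lift ord0 i) - p ord0)).

(* A topological space presented as a union of images of convex polytopes;
   its piecewise linear structure is the one carried by these cells. *)
Record cellSpace := CellSpace {
  carrier :> topologicalType;
  ambient : nat;
  cell : Type;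
  body : cell -> set 'rV[R]_ambient;
  chart : forall c : cell, body c -> carrier }.

Definition cell_dimension (X : cellSpace) (d : nat) : Prop :=
  (exists c : cell X, dim_ge (body c) d) /\
  (forall c : cell X, ~ dim_ge (body c) d.+1).

(* Y need not sit in a vector space, so "piecewise affine" is expressed in the
   charts of both X and Y. *)
Definition pl_map (X Y : cellSpace) (f : X -> Y) : Prop :=
  forall c : cell X, exists (q : nat) (S : 'I_q -> set 'rV[R]_(ambient X)),
    [/\ forall t, polyhedron (S t),
        body c `<=` \bigcup_(t in [set: 'I_q]) S t &
        forall t, exists (c' : cell Y) (M : 'M[R]_(ambient X, ambient Y))
                         (v : 'rV[R]_(ambient Y)),
          forall z : body c, S t (val z) ->
            exists w : body c',
              val w = val z *m M + v /\ f (chart z) = chart w].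

Definition pl_homeomorphic (X Y : cellSpace) : Prop :=
  exists (f : X -> Y) (g : Y -> X),
    [/\ cancel f g, cancel g f, continuous f & continuous g] /\
    pl_map f /\ pl_map g.

Definition simplex_set (d : nat) : set 'rV[R]_d.+1 :=
  [set z | (forall i, 0 <= z 0 i) /\ \sum_i z 0 i = 1].

Definition standard_simplex (d : nat) : cellSpace :=
  @CellSpace (set_type (@simplex_set d)) d.+1 unit
    (fun=> @simplex_set d) (fun=> id).

Section DualComplex.
Variables n N : nat.

Definition polytope (x : label n N) : set 'rV[R]_n.+1 :=
  [set z | simplex_set z /\
     \sum_(i | 2 * kk x < height x i) z 0 i
       = \sum_(i | height x i < 2 * kk x) z 0 i].

Definition polytope_space (c : deepest n N) : topologicalType :=
  set_type (polytope (val c)).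

Definition polytopes : topologicalType := {c : deepest n N & polytope_space c}.

Definition coords (p : polytopes) : 'rV[R]_n.+1 := val (projT2 p).

Definition supp (z : 'rV[R]_n.+1) : {set 'I_n.+1} := [set i | z 0 i != 0]%SET.

Definition same_point (p q : polytopes) : bool :=
  (coords p == coords q) &&
  (mtuple (supp (coords p)) (val (projT1 p))
     == mtuple (supp (coords p)) (val (projT1 q))).

Lemma same_point_equiv : equiv_class_of same_point.
Proof.
split; rewrite /same_point.
- by move=> p; rewrite !eqxx.
- move=> p q; apply/idP/idP => /andP[/eqP e /eqP h];
    by rewrite e eqxx -?e h eqxx.
- move=> q p r /andP[/eqP e1 /eqP h1] /andP[/eqP e2 /eqP h2].
  by rewrite e1 e2 eqxx /= -e2 -e1 h1 e1 h2 eqxx.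
Qed.

Canonical same_point_equivRel := EquivRelPack same_point_equiv.

Definition glued : topologicalType := quotient_topology {eq_quot same_point}.

Definition dual_complex : cellSpace :=
  @CellSpace glued n.+1 (deepest n N)
    (fun c => polytope (val c))
    (fun c z => \pi_({eq_quot same_point}) (existT polytope_space c z)).

End DualComplex.
End PL.

(* Main.v *)
From HB Require Import structures.
Require Import Defs.
From mathcomp Require Import all_boot all_order all_algebra all_fingroup.
From mathcomp Require Import all_classical all_reals all_analysis.
From mathcomp Require Import ring lra zify.

Set Implicit Arguments.
Unset Strict Implicit.
Unset Printing Implicit Defensive.

Import Order.TTheory GRing.Theory Num.Theory.
Import numFieldNormedType.Exports.

Local Open Scope ring_scope.
Local Open Scope quotient_scope.

(** A point z of the cell with label (eps, tau, k) is read as an unordered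
    triple of points of the circle R / 2N, namely x_i = 2 tau_i + eps_i t_i, where
    0 <= t_1 <= t_2 <= t_3 <= 1 are essentially the partial sums of z: on the
    circle, t_i is the distance from x_i to the nearest even integer, eps_i says
    on which side of it x_i lies and 2 tau_i is that even integer.  The balance
    condition that cuts out the cell becomes x_1 + x_2 + x_3 = 0 mod 2N.  Hence
    the glued complex is the torus of triples with zero sum modulo the symmetric
    group S_3, that is, the plane x_1 + x_2 + x_3 = 0 modulo the affine Weyl group
    of type A_2.  Its quotient is the fundamental alcove
    x_1 >= x_2 >= x_3 >= x_1 - 2N, a triangle, whose barycentric coordinates are
    the gaps between the three points divided by 2N.

    With plain partial sums, the signed sum of the t_i would weight each z_i by its
    height s_i, whereas the balance of z only takes the sign of s_i - 2k into
    account.  The two agree after the linear change of coordinates that adds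
    (z_1 - z_3) / 3 to z_1 and removes it from z_4.  It works for all labels at
    once because only four sign patterns are admissible for n = 3: eps constant
    with k = eps, where the balance reads z_1 = z_3 + z_4, and
    eps_1 = eps_2 = - eps_3 with k = 0, where it reads z_1 = z_3.

    Four facts carry the proof.  [same_point_orbit]: two points of cells are glued
    exactly when their triples agree on the circle up to order; the residues
    2 tau_i (b + 1) + eps_i c_I(i) counted by m correspond to the x_i under an
    injection of Z / 2N(b + 1) into the circle which depends only on z.
    [alcove_exists] and [alcove_uniq]: every triple with sum 0 mod 2N agrees in
    this sense with exactly one point of the alcove.  [label_exists]: every triple
    with zero sum comes from a cell; when some t_i vanishes the sign eps_i is free,
    and this freedom is enough to reach one of the four patterns.  So the relation
    of having the same triple up to order, between points of cells and points of
    the simplex, induces a bijection on the glued complex.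

    Both this bijection and its inverse are piecewise affine because an orbit is
    reached by finitely many permutations and translations of bounded size.
    Continuity is then automatic: a map which is affine on the members of a finite
    closed cover of each cell is continuous ([pl_map_continuous]).  Finally each
    cell spans a plane, being cut out of its 4-dimensional ambient space by two
    independent linear equations. *)

(** * Permutations, folding and orbits *)

Local Notation p0 := (@Ordinal 3 0 isT).
Local Notation p1 := (@Ordinal 3 1 isT).
Local Notation p2 := (@Ordinal 3 2 isT).

Lemma ord3P (i : 'I_3) : [\/ i = p0, i = p1 | i = p2].
Proof.
by case: i => [[|[|[|]]]] // h; [apply: Or31|apply: Or32|apply: Or33]; apply: val_inj.
Qed.

Lemma sum3 (V : nmodType) (F : 'I_3 -> V) : \sum_i F i = F p0 + F p1 + F p2.
Proof.
rewrite !big_ord_recl big_ord0 addr0 addrA.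
by congr (F _ + F _ + F _); apply: val_inj.
Qed.

Lemma sum3_perm (V : nmodType) (F : 'I_3 -> V) (s : 'S_3) :
  \sum_i F (s i) = F p0 + F p1 + F p2.
Proof. by rewrite -sum3 [RHS](reindex_inj (@perm_inj _ s)). Qed.

(** Two families with the same multiplicities differ by a permutation: both are
    enumerations of one multiset. The tuples m are compared through this lemma. *)
Lemma perm_of_fibers (T : finType) n (F G : 'I_n -> T) :
  (forall t, #|[set i | F i == t]%SET| = #|[set i | G i == t]%SET|) ->
  exists s : 'S_n, forall i, F i = G (s i).
Proof.
move=> FG.
have : perm_eq (codom F) [tuple G i | i < n].
  apply/allP => t _ /=; rewrite /codom /image_mem !count_map.
  have card (H : 'I_n -> T) :
      #|[set i | H i == t]%SET| = count (preim H (pred1 t)) (enum 'I_n).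
    by rewrite cardE size_filter -enumT; apply: eq_count => i; rewrite /= inE.
  have := FG t; rewrite !card !enumT => E; apply/eqP; exact: E.
case/tuple_permP => s Es; exists s => i.
have := congr1 (fun u => nth (F i) u i) Es.
rewrite (nth_map i) ?size_enum_ord // nth_ord_enum => ->.
rewrite (nth_map i) ?size_enum_ord // nth_ord_enum.
by rewrite tnth_mktuple.
Qed.

Lemma fibers_of_perm (T : finType) n (F G : 'I_n -> T) (s : 'S_n) t :
  (forall i, F i = G (s i)) ->
  #|[set i | F i == t]%SET| = #|[set i | G i == t]%SET|.
Proof.
move=> FG; rewrite -(card_imset _ (@perm_inj _ s)).
congr #|pred_of_set _|; apply/setP => i; rewrite inE.
apply/imsetP/idP => [[j]|Gi]; first by rewrite inE FG => + ->.
by exists (s^-1 i)%g; rewrite ?permKV // inE FG permKV.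
Qed.

Lemma sort_perm disp (T : orderType disp) n (t : 'I_n -> T) :
  exists s : 'S_n, forall i j : 'I_n, (i <= j)%N -> (t (s i) <= t (s j))%O.
Proof.
have : perm_eq (sort <=%O (codom t)) [tuple t i | i < n] by rewrite perm_sort perm_refl.
case/tuple_permP => s Es; exists s => i j ij.
have nthE (k : 'I_n) : nth (t k) (sort <=%O (codom t)) k = t (s k).
  by rewrite Es (nth_map k) ?size_enum_ord // nth_ord_enum tnth_mktuple.
have sz : size (sort <=%O (codom t)) = n by rewrite size_sort size_codom card_ord.
rewrite -[t (s i)]nthE -[t (s j)]nthE (set_nth_default (t i)) ?sz //.
apply: sorted_leq_nth => //; rewrite ?inE ?sz //; first exact: le_trans.
exact: sort_le_sorted.
Qed.

(** The map (m, e, t) |-> 2 m h + (-1)^e t, with 0 <= t <= h, covers the line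
    by segments that meet only at their endpoints, the multiples of h, where t = 0
    or t = h. So a coincidence of values forces equal t and, unless the point is such
    a fold, equal m and e. The integral case h = b + 1 governs the entries of m
    and the real case h = 1 the points x_i. *)
Lemma fold_eq (D : realDomainType) (m : int) (h t t' : D) (e e' : bool) :
  0 < h -> 0 <= t <= h -> 0 <= t' <= h ->
  2 * m%:~R * h + (-1) ^+ e * t = (-1) ^+ e' * t' ->
  t = t' /\ [\/ m = 0 /\ e = e', m = 0 /\ t = 0, [/\ m = 1, t = h, e & ~~ e'] |
                [/\ m = -1, t = h, ~~ e & e']].
Proof.
move=> h0 /andP[t0 th] /andP[t0' th'].
have mul1 x (b : bool) : (-1) ^+ b * x = if b then - x else x :> D.
  by case: b; rewrite ?expr1 ?expr0 ?mulN1r ?mul1r.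
rewrite !mul1 => E.
have mle : (m <= 1)%R.
  rewrite leNgt; apply/negP => m2.
  have : (2%:~R <= m%:~R :> D) by rewrite ler_int; lia.
  case: e E; case: e' => E M; nra.
have mge : (-1 <= m)%R.
  rewrite leNgt; apply/negP => m2.
  have : (m%:~R <= (-2)%:~R :> D) by rewrite ler_int; lia.
  rewrite mulrNz.
  case: e E; case: e' => E M; nra.
have [m0|[m0|m0]] : m = 0 \/ m = 1 \/ m = -1 by lia.
- move: E; rewrite m0 mulr0 mul0r add0r; case: e; case: e' => E;
    (have tt' : t = t' by lra); (split=> //).
  + by apply: Or41.
  + by apply: Or42; split=> //; lra.
  + by apply: Or42; split=> //; lra.
  + by apply: Or41.
- move: E; rewrite m0 mulr1; case: e; case: e' => E; try (exfalso; lra).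
  + split; [lra | apply: Or43; split=> //; lra].
- move: E; rewrite m0 mulrNz; case: e; case: e' => E; try (exfalso; lra).
  + split; [lra | apply: Or44; split=> //; lra].
Qed.

Lemma fold_eq_rev (D : realDomainType) (m : int) (h t : D) (e e' : bool) :
  [\/ m = 0 /\ e = e', m = 0 /\ t = 0, [/\ m = 1, t = h, e & ~~ e'] |
                [/\ m = -1, t = h, ~~ e & e']] ->
  2 * m%:~R * h + (-1) ^+ e * t = (-1) ^+ e' * t.
Proof.
case=> [[-> ->]|[-> ->]|[-> -> -> /negbTE ->]|[-> -> /negbTE -> ->]];
  rewrite ?mulrNz /=; ring.
Qed.

Section Orbits.
Variables (R : realType) (n : nat) (L : R).
Implicit Types x y : 'I_n -> R.

(** Equality of unordered n-tuples of points of the circle R / L. *)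
Definition orbit x y := exists (s : 'S_n) (v : 'I_n -> int),
  forall i, x i = y (s i) + L * (v i)%:~R.

Lemma orbit_sym x y : orbit x y -> orbit y x.
Proof.
case=> s [v xy]; exists s^-1%g, (fun i => - v (s^-1 i)%g) => i.
by rewrite xy permKV mulrNz mulrN addrK.
Qed.

Lemma orbit_trans y x z : orbit x y -> orbit y z -> orbit x z.
Proof.
case=> s [v xy] [s' [v' yz]]; exists (s * s')%g, (fun i => v i + v' (s i)) => i.
by rewrite xy yz permM mulrzDr mulrDr; ring.
Qed.

End Orbits.

Section Alcove.
Variables (R : realType) (L : R).
Hypothesis L0 : 0 < L.
Implicit Types x : 'I_3 -> R.

(** The fundamental alcove of the affine Weyl group of type A_2 of period L. *)
Definition in_alcove x :=
  [/\ x p0 >= x p1, x p1 >= x p2, x p2 >= x p0 - L & x p0 + x p1 + x p2 = 0].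

Lemma alcove_bounds x i : in_alcove x ->
  [/\ x i <= x p0, x p2 <= x i, x p0 - L <= x i & x i <= x p2 + L].
Proof. by move=> [x01 x12 x20 _]; case: (ord3P i) => ->; split; lra. Qed.

(** A shift by v with zero sum has either all entries zero, so that the largest
    entries agree, or an entry v_i <= -1. In the second case x_1 <= x_i + L because x
    lies in the alcove, and x_i + L is at most an entry of y. The bound from below is
    symmetric. *)
Lemma alcove_extremal x y : in_alcove x -> in_alcove y -> orbit L x y ->
  x p0 <= y p0 /\ y p2 <= x p2.
Proof.
move=> xA yA [s [v xy]].
have vs : v p0 + v p1 + v p2 = 0.
  have [_ _ _ xs] := xA; have [_ _ _ ys] := yA.
  have S := sum3_perm y s; rewrite sum3 in S.
  have : L * (v p0 + v p1 + v p2)%:~R = 0.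
    by rewrite !mulrzDr; move: xs; rewrite !xy; lra.
  by move/eqP; rewrite mulf_eq0 gt_eqF //= intr_eq0 => /eqP.
have xB := alcove_bounds _ xA; have yB := alcove_bounds _ yA.
have [/forallP v0|/forallPn[j vj]] := boolP [forall j, v j == 0].
  have [? _ _ _] := yB (s p0); have [_ ? _ _] := yB (s p2).
  by rewrite !xy !(eqP (v0 _)) mulr0 !addr0.
have [i vi] : exists i, v i <= -1.
  have [|h0] := leP (v p0) (-1); first by exists p0.
  have [|h1] := leP (v p1) (-1); first by exists p1.
  exists p2; move: vj; case: (ord3P j) => ->; lia.
have [k vk] : exists i, 1 <= v i.
  have [|h0] := leP 1 (v p0); first by exists p0.
  have [|h1] := leP 1 (v p1); first by exists p1.
  exists p2; move: vi; case: (ord3P i) => ->; lia.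
have Lvi : L * (v i)%:~R <= - L.
  by rewrite -mulrN1 ler_pM2l // -[leRHS]/((-1)%:~R) ler_int.
have Lvk : L <= L * (v k)%:~R by rewrite ler_peMr ?(ltW L0) // ler1z.
have [_ _ xi _] := xB i; have [yi _ _ _] := yB (s i).
have [_ _ _ xk] := xB k; have [_ yk _ _] := yB (s k).
by move: (xy i) (xy k) => xyi xyk; split; lra.
Qed.

Lemma alcove_uniq x y : in_alcove x -> in_alcove y -> orbit L x y ->
  forall i, x i = y i.
Proof.
move=> xA yA xy i.
have [a b] := alcove_extremal xA yA xy.
have [c d] := alcove_extremal yA xA (orbit_sym xy).
have [_ _ _ xs] := xA; have [_ _ _ ys] := yA.
by case: (ord3P i) => ->; lra.
Qed.

(** Reduce each entry to [0, L) and sort. The sum is then 0, L or 2 L, and lowering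
    the one or two largest entries by L makes it vanish without leaving an interval
    of length L. *)
Lemma alcove_exists x (m : int) : x p0 + x p1 + x p2 = L * m%:~R ->
  exists y, orbit L x y /\ in_alcove y.
Proof.
move=> xsum.
have [u uP] : exists u : 'I_3 -> R, forall i,
    0 <= u i < L /\ exists v : int, x i = u i + L * v%:~R.
  have ex i : exists w, 0 <= w < L /\ exists v : int, x i = w + L * v%:~R.
    exists (x i - L * (Num.floor (x i / L))%:~R); split; last first.
      by exists (Num.floor (x i / L)); rewrite subrK.
    have := floor_itv (x i / L); rewrite intrD mulr1z.
    rewrite ler_pdivlMr // ltr_pdivrMr // => /andP[l r].
    apply/andP; split; lra.
  by exists (fun i => projT1 (cid (ex i))) => i; case: (cid (ex i)).
have [v vP] : exists v : 'I_3 -> int, forall i, x i = u i + L * (v i)%:~R.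
  exists (fun i => projT1 (cid (uP i).2)) => i /=.
  by case: (cid _).
have [s sP] := sort_perm u.
pose w i := u (s i).
have w01 : w p0 <= w p1 by exact: sP.
have w12 : w p1 <= w p2 by exact: sP.
have xw : orbit L x w.
  apply: orbit_sym; exists s, (fun i => - v (s i)) => i.
  by rewrite vP mulrNz mulrN addrK.
have /andP[w0 _] : 0 <= w p0 < L := (uP _).1.
have /andP[_ w2] : 0 <= w p2 < L := (uP _).1.
pose k := m - (v p0 + v p1 + v p2).
have wsum : w p0 + w p1 + w p2 = L * k%:~R.
  rewrite -(sum3 w) (sum3_perm u) /k mulrzBr !mulrzDr mulrBr.
  by move: xsum; rewrite !vP; lra.
have k3 : (k < 3)%R.
  by rewrite -(ltr_int R) -(ltr_pM2l L0) -wsum; lra.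
have k0 : (-1 < k)%R.
  by rewrite -(ltr_int R) -(ltr_pM2l L0) -wsum mulrNz; lra.
have [ke|[ke|ke]] : k = 0 \/ k = 1 \/ k = 2 by lia.
- exists w; split=> //; move: wsum; rewrite ke mulr0 => ws; split; lra.
(* y = (w_2, w_1, w_3 - L) *)
- pose y i := w (tperm p0 p1 i) + L * (if i == p2 then -1 else 0 : int)%:~R.
  exists y; split.
    apply: orbit_trans xw _; apply: orbit_sym.
    by exists (tperm p0 p1), (fun i => if i == p2 then -1 else 0).
  move: wsum; rewrite ke /in_alcove /y /= tpermL tpermR tpermD //= mulrNz => ws.
  split; lra.
(* y = (w_1, w_3 - L, w_2 - L) *)
- pose y i := w (tperm p1 p2 i) + L * (if i == p0 then 0 else -1 : int)%:~R.
  exists y; split.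
    apply: orbit_trans xw _; apply: orbit_sym.
    by exists (tperm p1 p2), (fun i => if i == p0 then 0 else -1).
  move: wsum; rewrite ke /in_alcove /y /= tpermL tpermR tpermD //= mulrNz => ws.
  split; lra.
Qed.

End Alcove.

(** * Coordinates on a cell *)

Local Notation q0 := (@Ordinal 4 0 isT).
Local Notation q1 := (@Ordinal 4 1 isT).
Local Notation q2 := (@Ordinal 4 2 isT).
Local Notation q3 := (@Ordinal 4 3 isT).

Lemma ord4P (i : 'I_4) : [\/ i = q0, i = q1, i = q2 | i = q3].
Proof.
by case: i => [[|[|[|[|]]]]] // h;
  [apply: Or41|apply: Or42|apply: Or43|apply: Or44]; apply: val_inj.
Qed.

Lemma sum4 (V : nmodType) (F : 'I_4 -> V) :
  \sum_i F i = F q0 + F q1 + F q2 + F q3.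
Proof.
rewrite !big_ord_recl big_ord0 addr0 !addrA.
by congr (F _ + F _ + F _ + F _); apply: val_inj.
Qed.

Lemma forall_ord3 (P : pred 'I_3) : [forall i, P i] = [&& P p0, P p1 & P p2].
Proof.
apply/forallP/and3P => [H|[? ? ?] i]; first by split.
by case: (ord3P i) => ->.
Qed.

Lemma exists_ord4 (P : pred 'I_4) : [exists i, P i] = [|| P q0, P q1, P q2 | P q3].
Proof.
apply/existsP/or4P => [[i]|]; last by case=> ?; eexists; eassumption.
by case: (ord4P i) => -> ?; [apply: Or41|apply: Or42|apply: Or43|apply: Or44].
Qed.

Lemma eq_sandwich (disp : Order.disp_t) (T : porderType disp) (a b c : T) :
  (a <= b)%O -> (b <= c)%O -> (a == c) = (a == b) && (b == c).
Proof.
move=> ab bc; apply/eqP/andP => [ac|[/eqP -> /eqP //]].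
have ba : b = a by apply/le_anti; rewrite ab ac bc.
by rewrite -ac ba !eqxx.
Qed.

(** Two nondecreasing sequences with the same constant steps have the same fibres. *)
Lemma same_plateaus (disp : Order.disp_t) (T : porderType disp)
  (f : nat -> T) (c : nat -> nat) m :
  (forall k, (k < m)%N -> (f k <= f k.+1)%O) ->
  (forall k, (k < m)%N -> (c k <= c k.+1)%N) ->
  (forall k, (k < m)%N -> (f k == f k.+1) = (c k == c k.+1)) ->
  forall i j, (i <= m)%N -> (j <= m)%N -> (f i == f j) = (c i == c j).
Proof.
move=> fS cS fcS i j; wlog ij : i j / (i <= j)%N.
  move=> W im jm; have [/W->//|/ltnW ji] := leqP i j.
  by rewrite eq_sym W // eq_sym.
move=> _ jm; suff : [/\ (f i <= f j)%O, (c i <= c j)%N & (f i == f j) = (c i == c j)].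
  by case.
elim: j ij jm => [|j IH]; first by rewrite leqn0 => /eqP ->; rewrite !eqxx.
rewrite leq_eqVlt => /predU1P[-> _|]; first by rewrite !eqxx.
rewrite ltnS => ij jm; have [fij cij E] := IH ij (ltnW jm).
split; [exact: le_trans (fS _ _) | exact: leq_trans (cS _ _) |].
by rewrite (eq_sandwich fij) ?fS // (@eq_sandwich _ nat _ (c j)) ?leEnat ?cS // E fcS.
Qed.

Section Labels.
Variable N : nat.
Implicit Types x : label 3 N.

Lemma heightE x : [/\ height x q0 = eps x p0 + eps x p1 + eps x p2,
  height x q1 = eps x p1 + eps x p2, height x q2 = eps x p2 & height x q3 = 0].
Proof.
by split; rewrite /height big_mkcond sum3 /= ?add0r ?addr0.
Qed.

Definition balanced_signs x : bool :=
  [|| (kk x == 1) && [forall i, ~~ x.1.1 i],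
      (kk x == -1) && [forall i, x.1.1 i] |
      [&& kk x == 0, x.1.1 p0 == x.1.1 p1 & x.1.1 p2 != x.1.1 p1]].

(** The heights form a walk with steps +1 or -1 that ends at 0, and 2k must lie
    strictly between its extreme values; parity leaves four of the eight walks. *)
Lemma admissible_setT x : admissible [set: 'I_4]%SET x =
  (N%:Z %| (\sum_i tau x i) + kk x)%Z && balanced_signs x.
Proof.
have [h0 h1 h2 h3] := heightE x.
have ne : [set: 'I_4]%SET != finset.set0 by apply/set0Pn; exists q0; rewrite inE.
rewrite /admissible ne /=; congr (_ && _).
have -> : [forall i in [set: 'I_4]%SET, height x i == 2 * kk x] = false.
  apply/negP => /forallP H; move: (H q2) (H q3).
  rewrite !inE h2 h3 /eps /=; case: (x.1.1 p2); rewrite ?expr1 ?expr0; lia.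
rewrite orbF !exists_ord4 !inE /= h0 h1 h2 h3 /balanced_signs !forall_ord3 /eps.
case: (x.1.1 p0); case: (x.1.1 p1); case: (x.1.1 p2); rewrite ?expr1 ?expr0 /=; lia.
Qed.

Lemma balanced_signsP x : balanced_signs x ->
  [\/ kk x = 1 /\ [/\ eps x p0 = 1, eps x p1 = 1 & eps x p2 = 1],
      kk x = -1 /\ [/\ eps x p0 = -1, eps x p1 = -1 & eps x p2 = -1],
      kk x = 0 /\ [/\ eps x p0 = 1, eps x p1 = 1 & eps x p2 = -1] |
      kk x = 0 /\ [/\ eps x p0 = -1, eps x p1 = -1 & eps x p2 = 1]].
Proof.
rewrite /balanced_signs !forall_ord3 /eps.
case: (x.1.1 p0); case: (x.1.1 p1); case: (x.1.1 p2);
  rewrite ?expr1 ?expr0 /= ?andbF ?andbT ?orbF //= => /eqP ->;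
  by [apply: Or41|apply: Or42|apply: Or43|apply: Or44].
Qed.

End Labels.

Section Polytope.
Variables (R : realType) (N : nat).
Implicit Types (x : label 3 N) (z : 'rV[R]_4).

(** Partial sums of z, after the change of coordinates (z_1 - z_3) / 3 that turns the
    balance condition into a condition on the sum of the points. *)
Definition tcoord z (i : 'I_3) : R :=
  \sum_(a < 4 | (a <= i)%N) z 0 a + (z 0 q0 - z 0 q2) / 3.

Lemma tcoordE z : [/\ tcoord z p0 = z 0 q0 + (z 0 q0 - z 0 q2) / 3,
  tcoord z p1 = tcoord z p0 + z 0 q1 & tcoord z p2 = tcoord z p1 + z 0 q2].
Proof.
have E i : tcoord z i = (if (0 <= i)%N then z 0 q0 else 0) +
    (if (1 <= i)%N then z 0 q1 else 0) + (if (2 <= i)%N then z 0 q2 else 0) +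
    (if (3 <= i)%N then z 0 q3 else 0) + (z 0 q0 - z 0 q2) / 3.
  by rewrite /tcoord big_mkcond sum4.
by split; rewrite !E /= ?addr0 // addrAC.
Qed.

Lemma simplex4P z : simplex_set z <->
  [/\ 0 <= z 0 q0, 0 <= z 0 q1, 0 <= z 0 q2, 0 <= z 0 q3 &
      z 0 q0 + z 0 q1 + z 0 q2 + z 0 q3 = 1].
Proof.
rewrite /simplex_set /= sum4; split=> [[H ->]|[? ? ? ? ->]]; first by split.
by split=> // i; case: (ord4P i) => ->.
Qed.

(** This is the purpose of the correction term in [tcoord]: on a cell the points
    x_i then have the constant sum 2 (tau_1 + tau_2 + tau_3 + k). *)
Lemma polytopeP x z : balanced_signs x -> polytope x z <->
  simplex_set z /\ \sum_i (eps x i)%:~R * tcoord z i = 2 * (kk x)%:~R.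
Proof.
move=> xb; have [h0 h1 h2 h3] := heightE x.
have [t0 t1 t2] := tcoordE z.
have -> : polytope x z = (simplex_set z /\
    (if 2 * kk x < height x q0 then z 0 q0 else 0) +
    (if 2 * kk x < height x q1 then z 0 q1 else 0) +
    (if 2 * kk x < height x q2 then z 0 q2 else 0) +
    (if 2 * kk x < height x q3 then z 0 q3 else 0) =
    (if height x q0 < 2 * kk x then z 0 q0 else 0) +
    (if height x q1 < 2 * kk x then z 0 q1 else 0) +
    (if height x q2 < 2 * kk x then z 0 q2 else 0) +
    (if height x q3 < 2 * kk x then z 0 q3 else 0)).
  by rewrite /polytope /= (big_mkcond (fun i => 2 * kk x < height x i))
    (big_mkcond (fun i => height x i < 2 * kk x)) !sum4.
rewrite sum3 simplex4P h0 h1 h2 h3 t2 t1 t0.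
by case: (balanced_signsP xb) => -[-> [-> -> ->]] /=; rewrite ?mulrNz ?mulr1z;
  split=> -[[? ? ? ? ?] ?]; do !split=> //; lra.
Qed.

Lemma simplex_supp_neq0 z : simplex_set z -> supp z != finset.set0.
Proof.
move=> [_ zs]; apply: contra_eqN zs => /eqP s0.
rewrite big1 ?(eq_sym _ 1) ?oner_eq0 // => i _.
by apply/eqP/negPn; have := finset.in_set0 i; rewrite -s0 inE => ->.
Qed.

Lemma card_belowE z : [/\
  card_below (supp z) p0 = (z 0 q0 != 0),
  card_below (supp z) p1 = ((z 0 q0 != 0)%R + (z 0 q1 != 0)%R)%N,
  card_below (supp z) p2 = ((z 0 q0 != 0)%R + (z 0 q1 != 0)%R + (z 0 q2 != 0)%R)%N &
  #|supp z| = ((z 0 q0 != 0)%R + (z 0 q1 != 0)%R + (z 0 q2 != 0)%R + (z 0 q3 != 0)%R)%N].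
Proof.
by split; rewrite /card_below -sum1_card big_mkcond sum4 !inE /= ?andbF ?andbT ?addn0;
  do ![case: eqP => _].
Qed.

Lemma tcoord_bounds x z : balanced_signs x -> polytope x z ->
  [/\ 0 <= tcoord z p0, tcoord z p0 <= tcoord z p1, tcoord z p1 <= tcoord z p2
    & tcoord z p2 <= 1].
Proof.
move=> xb /(polytopeP _ xb); have [t0 t1 t2] := tcoordE z.
rewrite sum3 simplex4P t2 t1 t0.
by case: (balanced_signsP xb) => -[-> [-> -> ->]] /=; rewrite ?mulrNz ?mulr1z;
  move=> -[[? ? ? ? ?] ?]; split; lra.
Qed.

(** The change of coordinates preserves the support of z. On the cell,
    z_1 - z_3 is 0 or z_4, which leaves z_4 the factor 1 or 2/3. *)
Lemma tcoord_support x z : balanced_signs x -> polytope x z ->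
  [/\ (tcoord z p0 == 0) = (z 0 q0 == 0),
      (tcoord z p1 == tcoord z p0) = (z 0 q1 == 0),
      (tcoord z p2 == tcoord z p1) = (z 0 q2 == 0) &
      (tcoord z p2 == 1) = (z 0 q3 == 0)].
Proof.
move=> xb /(polytopeP _ xb); have [t0 t1 t2] := tcoordE z.
rewrite sum3 simplex4P t2 t1 t0.
by case: (balanced_signsP xb) => -[-> [-> -> ->]] /=; rewrite ?mulrNz ?mulr1z;
  move=> -[[? ? ? ? ?] ?]; split; apply/eqP/eqP => ?; lra.
Qed.

(** The integers c_I(i) and the reals t_i grow at the same indices, namely those
    in the support of z. So c_I(i) and t_i determine each other, and the folds 0 and
    b + 1 correspond to 0 and 1. *)
Lemma tcoord_card x z : balanced_signs x -> polytope x z ->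
  let c := card_below (supp z) in
  [/\ forall i j, (tcoord z i == tcoord z j) = (c i == c j),
      forall i, (tcoord z i == 0) = (c i == 0)%N,
      forall i, (tcoord z i == 1) = (c i == #|supp z|),
      forall i, 0 <= tcoord z i <= 1 & forall i, (c i <= #|supp z|)%N].
Proof.
move=> xb zP /=.
have [e0 e1 e2 e3] := tcoord_support xb zP.
have [b0 b1 b2 b3] := tcoord_bounds xb zP.
have [c0 c1 c2 c3]:= card_belowE z.
pose f k := nth 0 [:: 0; tcoord z p0; tcoord z p1; tcoord z p2; 1] k.
pose d k := nth 0%N [:: 0%N; card_below (supp z) p0; card_below (supp z) p1;
                card_below (supp z) p2; #|supp z|] k.
have fS k : (k < 4)%N -> f k <= f k.+1 by case: k => [|[|[|[|]]]].
have dS k : (k < 4)%N -> (d k <= d k.+1)%N.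
  by case: k => [|[|[|[|]]]] //= _; rewrite /d /= ?c0 ?c1 ?c2 ?c3 ?leq_addr.
have fd k : (k < 4)%N -> (f k == f k.+1) = (d k == d k.+1).
  have plateau (m : nat) (b : bool) : (m == m + ~~ b)%N = b.
    by case: b; rewrite ?addn0 ?eqxx // addn1 ltn_eqF.
  case: k => [|[|[|[|]]]] //= _; rewrite /f /d /=.
  - by rewrite eq_sym e0 c0 -[RHS]/(0 == 0 + _)%N plateau.
  - by rewrite eq_sym e1 c1 c0 plateau.
  - by rewrite eq_sym e2 c2 c1 plateau.
  - by rewrite e3 c3 c2 plateau.
have E := same_plateaus fS dS fd.
have lt4 (i : 'I_3) : (i.+1 <= 4)%N by rewrite ltnS ltnW // ltnW.
have fi i : tcoord z i = f i.+1 by case: (ord3P i) => ->.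
have di i : card_below (supp z) i = d i.+1 by case: (ord3P i) => ->.
split=> [i j|i|i|i|i].
- by rewrite !fi !di E.
- by rewrite fi di -[LHS]/(_ == f 0) E.
- by rewrite fi di -[LHS]/(_ == f 4) E.
- by case: (ord3P i) => ->; apply/andP; split; lra.
- by apply: subset_leq_card; apply/fintype.subsetP => a; rewrite inE => /andP[].
Qed.
End Polytope.

(** * Glued points are points with the same orbit *)

Section Positions.
Variables (n N : nat).
Hypothesis N0 : (0 < N)%N.
Implicit Types x : label n N.

(** Its residue modulo 2 N (b + 1) is the index of the component that contains the
    i-th point. *)
Definition position (I : {set 'I_n.+1}) x (i : 'I_n) : int :=
  2 * tau x i * (#|I|.-1.+1)%:Z + eps x i * (card_below I i)%:Z.

Lemma mtuple_eqP I x x' : mtuple I x = mtuple I x' <->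
  exists s : 'S_n, forall i,
    (position I x i == position I x' (s i) %[mod (2 * N * #|I|.-1.+1)%N%:Z])%Z.
Proof.
set M := (2 * N * _)%N; have M0 : (0 < M)%N by rewrite !muln_gt0 N0.
have Mz : (M%:Z != 0)%R by rewrite -lt0n.
have resP (p : int) : (`|(p %% M%:Z)%Z| < M)%N.
  by rewrite -ltz_nat gez0_abs ?modz_ge0 // ltz_pmod.
pose res (p : int) : 'I_M := Ordinal (resP p).
have res_eq p (j : 'I_M) : (p == (j : nat)%:Z %[mod M%:Z])%Z = (res p == j).
  rewrite -val_eqE /= (@modz_small j) ?ltz_nat ?ltn_ord //.
  by rewrite -eqz_nat gez0_abs ?modz_ge0.
have res_inj p p' : (res p == res p') = (p == p' %[mod M%:Z])%Z.
  by rewrite -val_eqE /= -eqz_nat !gez0_abs ?modz_ge0.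
have mE y j : mtuple I y j = #|[set i | res (position I y i) == j]%SET|.
  by rewrite ffunE; congr #|pred_of_set _|; apply/setP => i; rewrite !inE -res_eq.
split=> [E|[s sP]].
  have [s sP] : exists s : 'S_n, forall i,
      res (position I x i) = res (position I x' (s i)).
    apply: (perm_of_fibers (F := fun i => res (position I x i))
      (G := fun i => res (position I x' i))) => j.
    by rewrite -!mE E.
  by exists s => i; rewrite -res_inj sP.
apply/ffunP => j; rewrite !mE; apply: (fibers_of_perm (s := s)) => i.
by apply/eqP; rewrite res_inj.
Qed.

End Positions.

Section LiftOrbits.
Variables (R : realType) (N : nat).
Hypothesis N0 : (0 < N)%N.
Implicit Types (x : label 3 N) (z : 'rV[R]_4).

Definition period : R := 2 * N%:R.

Lemma period_gt0 : 0 < period.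
Proof. by rewrite mulr_gt0 // ltr0n. Qed.

(** The point x_i on the universal cover of the circle R / 2N. *)
Definition torus_point x z (i : 'I_3) : R :=
  2 * (tau x i)%:~R + (eps x i)%:~R * tcoord z i.

Lemma epsE x i : (eps x i)%:~R = (-1) ^+ (x.1.1 i) :> R.
Proof. by rewrite /eps rmorphXn /= mulrNz. Qed.

(** For a fixed z the integer positions and the real points are folded in the same
    way, so [fold_eq] transports congruences between them in both directions. *)
Lemma same_mtuple_orbit x x' z : balanced_signs x -> balanced_signs x' ->
  polytope x z -> polytope x' z ->
  mtuple (supp z) x = mtuple (supp z) x' <->
  orbit period (torus_point x z) (torus_point x' z).
Proof.
move=> xb xb' zP zP'.
have [eqc eq0 eq1 bt bc] := tcoord_card xb zP.
have hE : #|supp z|.-1.+1 = #|supp z|.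
  by rewrite prednK // lt0n cards_eq0; apply: simplex_supp_neq0; case: zP.
rewrite mtuple_eqP // /position hE.
set h := #|supp z|; set c := card_below (supp z).
have h0 : (0 < h%:Z)%R by rewrite ltz_nat /h -hE.
split=> [[s sP]|[s [v sP]]].
- have q i : exists q : int, 2 * tau x i * h%:Z + eps x i * (c i)%:Z =
      2 * tau x' (s i) * h%:Z + eps x' (s i) * (c (s i))%:Z + q * (2 * N * h)%N%:Z.
    have := sP i; rewrite eqz_mod_dvd => /dvdzP[q Eq]; exists q.
    by rewrite -Eq; ring.
  exists s, (fun i => projT1 (cid (q i))) => i; case: (cid (q i)) => {}q /= E.
  have := @fold_eq _ (tau x i - tau x' (s i) - N%:Z * q) h%:Z (c i)%:Z (c (s i))%:Z
    (x.1.1 i) (x'.1.1 (s i)) h0.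
  rewrite !lez_nat !bc => /(_ isT isT) [].
    by rewrite intz; move: E; rewrite /eps !PoszM; lia.
  move=> /eqP; rewrite eqz_nat -eqc => /eqP tt alt.
  have := @fold_eq_rev R (tau x i - tau x' (s i) - N%:Z * q) 1 (tcoord z i)
    (x.1.1 i) (x'.1.1 (s i)).
  rewrite -!epsE !intrD !mulrNz intrM => F.
  rewrite /torus_point /period -tt -F; first by rewrite -pmulrn; ring.
  case: alt => [[? ?]|[? /eqP]|[? /eqP + ? ?]|[? /eqP + ? ?]]; rewrite ?eqz_nat.
  + by apply: Or41.
  + by rewrite -[(c i == 0)%N]eq0 => /eqP ?; apply: Or42.
  + by rewrite -eq1 => /eqP ?; apply: Or43.
  + by rewrite -eq1 => /eqP ?; apply: Or44.
- exists s => i; rewrite eqz_mod_dvd; apply/dvdzP; exists (v i).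
  have := @fold_eq R (tau x i - tau x' (s i) - N%:Z * v i) 1 (tcoord z i)
     (tcoord z (s i)) (x.1.1 i) (x'.1.1 (s i)) ltr01 (bt _) (bt _).
  rewrite -!epsE !intrD !mulrNz intrM => -[].
    by have := sP i; rewrite /torus_point /period -pmulrn; lra.
  move=> /eqP; rewrite eqc => /eqP cc alt.
  have := @fold_eq_rev int (tau x i - tau x' (s i) - N%:Z * v i) h%:Z (c i)%:Z
    (x.1.1 i) (x'.1.1 (s i)).
  rewrite intz -/c => F; have {}cc : c i = c (s i) := cc.
  move: F; rewrite /eps cc !PoszM => F.
  suff G : 2 * (tau x i - tau x' (s i) - N%:Z * v i) * h%:Z
          + (-1) ^+ x.1.1 i * (c (s i))%:Z = (-1) ^+ x'.1.1 (s i) * (c (s i))%:Z.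
    by apply: subr0_eq; move/eqP: G; rewrite -subr_eq0 => /eqP G; rewrite -[RHS]G; ring.
  apply: F.
  case: alt => [[? ?]|[? /eqP]|[? /eqP + ? ?]|[? /eqP + ? ?]].
  + by apply: Or41.
  + by rewrite eq0 => /eqP; rewrite -/c cc => cE; apply: Or42; rewrite cE.
  + by rewrite eq1 => /eqP; rewrite -/c cc => cE; apply: Or43; rewrite cE.
  + by rewrite eq1 => /eqP; rewrite -/c cc => cE; apply: Or44; rewrite cE.
Qed.

Lemma orbit_tcoord x x' z z' : balanced_signs x -> balanced_signs x' ->
  polytope x z -> polytope x' z' -> orbit period (torus_point x z) (torus_point x' z') ->
  exists s : 'S_3, forall i, tcoord z i = tcoord z' (s i).
Proof.
move=> xb xb' zP zP' [s [v sP]]; exists s => i.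
have [_ _ _ bt _] := tcoord_card xb zP.
have [_ _ _ bt' _] := tcoord_card xb' zP'.
have := @fold_eq R (tau x i - tau x' (s i) - N%:Z * v i) 1 (tcoord z i)
     (tcoord z' (s i)) (x.1.1 i) (x'.1.1 (s i)) ltr01 (bt _) (bt' _).
rewrite -!epsE !intrD !mulrNz intrM => -[] //.
by have := sP i; rewrite /torus_point /period -pmulrn; lra.
Qed.

(** The orbit determines the multiset of the t_i, hence the t_i themselves because
    they are sorted, hence z. *)
Lemma orbit_coords x x' z z' : balanced_signs x -> balanced_signs x' ->
  polytope x z -> polytope x' z' ->
  orbit period (torus_point x z) (torus_point x' z') -> z = z'.
Proof.
move=> xb xb' zP zP' /orbit_tcoord [] // s sP.
have [b0 b1 b2 b3] := tcoord_bounds xb zP.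
have [c0 c1 c2 c3] := tcoord_bounds xb' zP'.
have sum_tt : tcoord z p0 + tcoord z p1 + tcoord z p2
    = tcoord z' p0 + tcoord z' p1 + tcoord z' p2.
  by rewrite -(sum3_perm (tcoord z') s) sum3 !sP.
have lo : tcoord z p0 = tcoord z' p0.
  apply/le_anti/andP; split.
    rewrite -[p0 in leRHS](permKV s) -sP.
    by case: (ord3P (s^-1 p0)%g) => ->; lra.
  by rewrite sP; case: (ord3P (s p0)) => ->; lra.
have hi : tcoord z p2 = tcoord z' p2.
  apply/le_anti/andP; split.
    by rewrite sP; case: (ord3P (s p2)) => ->; lra.
  rewrite -[p2 in leLHS](permKV s) -sP.
  by case: (ord3P (s^-1 p2)%g) => ->; lra.
have [t0 t1 t2] := tcoordE z; have [u0 u1 u2] := tcoordE z'.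
have [/simplex4P[_ _ _ _ zs] _] := zP.
have [/simplex4P[_ _ _ _ zs'] _] := zP'.
apply/rowP => i; clear b0 b1 b2 b3 c0 c1 c2 c3 zP zP' sP.
by case: (ord4P i) => ->; lra.
Qed.

End LiftOrbits.

(** * Labels for all points of the torus, and barycentric coordinates of the alcove *)

Section LabelExists.
Variables (R : realType) (N : nat).
Hypothesis N0 : (0 < N)%N.
Implicit Types (x : label 3 N) (z : 'rV[R]_4) (t : 'I_3 -> R).

Lemma fold_exists (r : R) : exists (m : int) (e : bool) (t : R),
  0 <= t <= 1 /\ r = 2 * m%:~R + (-1) ^+ e * t.
Proof.
pose m := Num.floor ((r + 1) / 2); pose d := r - 2 * m%:~R.
exists m, (d < 0), `|d|; rewrite -numEsign normr_ge0 ler_norml /= {2}/d.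
have := floor_itv ((r + 1) / 2); rewrite intrD mulr1z -/m /d => /andP[l u].
split; last by lra.
by apply/andP; split; lra.
Qed.

(** Since |2 k| <= 3, only k = 1, -1 and 0 occur. A sign that does not fit the pattern
    required by k forces the corresponding t_i to vanish, because the t_i are sorted in
    [0, 1]; that sign can then be reversed. *)
Lemma flip_signs t (e : 'I_3 -> bool) (k : int) :
  0 <= t p0 -> t p0 <= t p1 -> t p1 <= t p2 -> t p2 <= 1 ->
  \sum_i (-1) ^+ e i * t i = 2 * k%:~R ->
  exists e' : {ffun 'I_3 -> bool},
    (forall tau : {ffun 'I_3 -> 'I_N}, balanced_signs (e', tau, k)) /\
    forall i, (-1) ^+ e' i * t i = (-1) ^+ e i * t i.
Proof.
move=> t0 t1 t2 t3 sk.
have sgn (b : bool) (r : R) : (-1) ^+ b * r = if b then - r else r.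
  by case: b; rewrite ?expr1 ?expr0 ?mulN1r ?mul1r.
rewrite sum3 !sgn in sk.
have k1 : (k < 2)%R.
  rewrite -(ltr_int R); move: sk; clear -t0 t1 t2 t3.
  by case: (e p0); case: (e p1); case: (e p2) => ?; lra.
have k2 : (-2 < k)%R.
  rewrite -(ltr_int R) mulrNz; move: sk; clear -t0 t1 t2 t3.
  by case: (e p0); case: (e p1); case: (e p2) => ?; lra.
have kE : k = 1 \/ k = -1 \/ k = 0 by clear -k1 k2; lia.
suff [e' [eb eP]] : exists e' : {ffun 'I_3 -> bool},
    (forall tau : {ffun 'I_3 -> 'I_N}, balanced_signs (e', tau, k)) /\
    forall i, e' i = e i \/ t i = 0.
  by exists e'; split=> // i; case: (eP i) => ->; rewrite // !mulr0.
case: kE sk => [|[|]] ->; rewrite ?mulrNz ?mulr1z ?mulr0z => sk.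
- exists [ffun=> false]; split=> [tau|i].
    by rewrite /balanced_signs forall_ord3 /= !ffunE.
  rewrite ffunE; clear k1 k2; move: sk.
  by case E0 : (e p0); case E1 : (e p1); case E2 : (e p2) => sk;
    case: (ord3P i) => ->; rewrite ?E0 ?E1 ?E2; (by left) || (right; lra).
- exists [ffun=> true]; split=> [tau|i].
    by rewrite /balanced_signs !forall_ord3 /= !ffunE.
  rewrite ffunE; clear k1 k2; move: sk.
  by case E0 : (e p0); case E1 : (e p1); case E2 : (e p2) => sk;
    case: (ord3P i) => ->; rewrite ?E0 ?E1 ?E2; (by left) || (right; lra).
- exists [ffun i => (i == p2) (+) ~~ e p2]; split=> [tau|i].
    by rewrite /balanced_signs !forall_ord3 /= !ffunE /=; case: (e p2).
  rewrite ffunE; clear k1 k2; move: sk.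
  by case E0 : (e p0); case E1 : (e p1); case E2 : (e p2) => sk;
    case: (ord3P i) => -> /=; rewrite ?E0 ?E1 ?E2; (by left) || (right; lra).
Qed.

(** The inverse of [tcoord] on the hyperplane where the coordinates sum to 1; the
    quotient by 4 is the correction (z_1 - z_3) / 3 expressed in the t_i. *)
Definition zcoord t : 'rV[R]_4 := \row_a
  nth 0 [:: t p0 - (t p0 + t p1 - t p2) / 4; t p1 - t p0; t p2 - t p1;
            1 - t p2 + (t p0 + t p1 - t p2) / 4] a.

Lemma zcoordE t : [/\ zcoord t 0 q0 = t p0 - (t p0 + t p1 - t p2) / 4,
  zcoord t 0 q1 = t p1 - t p0, zcoord t 0 q2 = t p2 - t p1 &
  zcoord t 0 q3 = 1 - t p2 + (t p0 + t p1 - t p2) / 4].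
Proof. by split; rewrite mxE. Qed.

Lemma zcoordK t i : tcoord (zcoord t) i = t i.
Proof.
have [z0 z1 z2 z3] := zcoordE t; have [t0 t1 t2] := tcoordE (zcoord t).
by case: (ord3P i) => ->; rewrite ?t2 ?t1 t0 ?z1 z2 z0; lra.
Qed.

Lemma tcoordK z : simplex_set z -> zcoord (tcoord z) = z.
Proof.
move=> /simplex4P[_ _ _ _ zs].
have [z0 z1 z2 z3] := zcoordE (tcoord z); have [t0 t1 t2] := tcoordE z.
by apply/rowP => i; case: (ord4P i) => ->; lra.
Qed.

Lemma zcoord_polytope x t : balanced_signs x ->
  (forall a, 0 <= zcoord t 0 a) ->
  \sum_i (eps x i)%:~R * t i = 2 * (kk x)%:~R -> polytope x (zcoord t).
Proof.
move=> xb z0 ts; apply/polytopeP => //; split; last first.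
  by rewrite -ts; apply: eq_bigr => i _; rewrite zcoordK.
apply/simplex4P; split; rewrite ?z0 //.
by have [-> -> -> ->] := zcoordE t; lra.
Qed.

Lemma zcoord_ge0 x t : balanced_signs x ->
  0 <= t p0 -> t p0 <= t p1 -> t p1 <= t p2 -> t p2 <= 1 ->
  \sum_i (eps x i)%:~R * t i = 2 * (kk x)%:~R -> forall a, 0 <= zcoord t 0 a.
Proof.
move=> xb t0 t1 t2 t3; rewrite sum3 => ts a.
have [z0 z1 z2 z3] := zcoordE t.
move: ts; case: (balanced_signsP xb) => -[-> [-> -> ->]];
  rewrite ?mulrNz ?mulr1z => ts; case: (ord4P a) => ->; rewrite ?z0 ?z1 ?z2 ?z3; lra.
Qed.

(** Round each entry of X to an even integer, sort by distance to it, and correct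
    the signs with [flip_signs]; k is determined by the sum of the roundings. *)
Lemma label_exists (X : 'I_3 -> R) : X p0 + X p1 + X p2 = 0 ->
  exists (x : label 3 N) (z : 'rV[R]_4),
    [/\ admissible [set: 'I_4]%SET x, polytope x z &
        orbit (period R N) (torus_point x z) X].
Proof.
move=> Xs.
have [m0 [e0 [t0 P0]]] : exists (m : 'I_3 -> int) (e : 'I_3 -> bool) (t : 'I_3 -> R),
    forall i, 0 <= t i <= 1 /\ X i = 2 * (m i)%:~R + (-1) ^+ e i * t i.
  have [m mP] := choice (fun i => fold_exists (X i)).
  have [e eP] := choice mP; have [t tP] := choice eP.
  by exists m, e, t.
have [s sP] := sort_perm t0.
pose m i := m0 (s i); pose t i := t0 (s i); pose k := - (m p0 + m p1 + m p2).
have XE i : X (s i) = 2 * (m i)%:~R + (-1) ^+ e0 (s i) * t i := (P0 (s i)).2.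
have t01 : t p0 <= t p1 by exact: sP.
have t12 : t p1 <= t p2 by exact: sP.
have /andP[tge0 _] : 0 <= t p0 <= 1 := (P0 _).1.
have /andP[_ tle1] : 0 <= t p2 <= 1 := (P0 _).1.
have [|e [eb eP]] := @flip_signs t (fun i => e0 (s i)) k tge0 t01 t12 tle1.
  move: Xs; rewrite -(sum3_perm X s) !sum3 !XE /k mulrNz !mulrzDr.
  by lra.
have modP i : (`|(m i %% N%:Z)%Z| < N)%N.
  by rewrite -ltz_nat gez0_abs ?modz_ge0 ?ltz_pmod // -lt0n.
pose x : label 3 N := (e, [ffun i => Ordinal (modP i)], k).
have xb : balanced_signs x := eb _.
have tauE i : tau x i = m i - (m i %/ N%:Z)%Z * N%:Z.
  by rewrite /tau /= ffunE /= gez0_abs ?modz_ge0 -?lt0n.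
have epsx i : (eps x i)%:~R = (-1) ^+ e i :> R by rewrite epsE.
have ts : \sum_i (eps x i)%:~R * t i = 2 * (kk x)%:~R.
  rewrite sum3 !epsx !eP /kk /= /k mulrNz !mulrzDr.
  by move: Xs; rewrite -(sum3_perm X s) sum3 !XE; lra.
exists x, (zcoord t); split.
- rewrite admissible_setT xb andbT sum3 !tauE /kk /=.
  apply/dvdzP; exists (- ((m p0 %/ N%:Z)%Z + (m p1 %/ N%:Z)%Z + (m p2 %/ N%:Z)%Z)).
  by rewrite /k; ring.
- apply: zcoord_polytope => //; exact: zcoord_ge0 ts.
- exists s, (fun i => - (m i %/ N%:Z)%Z) => i.
  rewrite /torus_point zcoordK epsx eP XE tauE /period rmorphB rmorphM /= mulrNz -pmulrn.
  by ring.
Qed.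

End LabelExists.

Section AlcoveCoordinates.
Variables (R : realType) (L : R).
Hypothesis L0 : 0 < L.
Implicit Types (y : 'rV[R]_3) (X : 'I_3 -> R).

(** The point of the alcove with barycentric coordinates y; the vertices of the
    alcove are 0, (2/3, -1/3, -1/3) L and (1/3, 1/3, -2/3) L. *)
Definition alcove_point y (i : 'I_3) : R :=
  L * nth 0 [:: (2 * y 0 p0 + y 0 p1) / 3; (y 0 p1 - y 0 p0) / 3;
                - (y 0 p0 + 2 * y 0 p1) / 3] i.

Definition gaps X : 'rV[R]_3 := \row_i
  nth 0 [:: (X p0 - X p1) / L; (X p1 - X p2) / L; (X p2 - X p0) / L + 1] i.

Lemma gapsE X : [/\ gaps X 0 p0 = (X p0 - X p1) / L,
  gaps X 0 p1 = (X p1 - X p2) / L & gaps X 0 p2 = (X p2 - X p0) / L + 1].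
Proof. by split; rewrite mxE. Qed.

Lemma simplex3P y : simplex_set y <->
  [/\ 0 <= y 0 p0, 0 <= y 0 p1, 0 <= y 0 p2 & y 0 p0 + y 0 p1 + y 0 p2 = 1].
Proof.
rewrite /simplex_set /= sum3; split=> [[H ->]|[? ? ? ->]]; first by split.
by split=> // i; case: (ord3P i) => ->.
Qed.

Lemma alcove_pointP y : simplex_set y -> in_alcove L (alcove_point y).
Proof.
move=> /simplex3P[y0 y1 y2 ys]; rewrite /in_alcove /alcove_point /=.
have a : 0 <= L * y 0 p0 by rewrite mulr_ge0 // ltW.
have b : 0 <= L * y 0 p1 by rewrite mulr_ge0 // ltW.
have c : 0 <= L * (1 - y 0 p0 - y 0 p1) by rewrite mulr_ge0 ?(ltW L0) //; lra.
by split; lra.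
Qed.

Lemma gaps_simplex X : (forall i, 0 <= gaps X 0 i) -> simplex_set (gaps X).
Proof.
move=> X0; apply/simplex3P; split=> //.
by have [-> -> ->] := gapsE X; field; rewrite gt_eqF.
Qed.

Lemma gapsK X : X p0 + X p1 + X p2 = 0 -> forall i, alcove_point (gaps X) i = X i.
Proof.
move=> Xs i; have Ln : L != 0 by rewrite gt_eqF.
have E j : L * (X j / L) = X j by field.
rewrite /alcove_point; have [-> -> _] := gapsE X.
have -> : X p2 = - X p0 - X p1 by lra.
by case: (ord3P i) => -> /=;
  first [field | rewrite (_ : X p2 = - X p0 - X p1); [field|lra]].
Qed.

Lemma gaps_ge0 X : in_alcove L X -> forall i, 0 <= gaps X 0 i.
Proof.
move=> [x01 x12 x20 _] i; have [g0 g1 g2] := gapsE X.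
have LV : 0 < L^-1 by rewrite invr_gt0.
by case: (ord3P i) => ->; rewrite ?g0 ?g1 ?g2 ?divr_ge0 ?(ltW L0) ?subr_ge0 //
  -[1](@divff _ L) ?gt_eqF // -mulrDl divr_ge0 ?(ltW L0) //; lra.
Qed.

Lemma alcove_pointK y : simplex_set y -> gaps (alcove_point y) = y.
Proof.
move=> /simplex3P[y0 y1 y2 ys]; apply/rowP => i; have Ln : L != 0 by rewrite gt_eqF.
have E : y 0 p2 = 1 - y 0 p0 - y 0 p1 by lra.
have [g0 g1 g2] := gapsE (alcove_point y).
case: (ord3P i) => ->; rewrite ?g0 ?g1 ?g2 ?E /alcove_point /=; by field.
Qed.

(** Bounding the shifts makes the Weyl group elements range over a finite type, as a
    piecewise affine map requires; 'I_5 encodes the integers from -2 to 2. *)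
Lemma orbit_bounded x X : (forall i, `|x i| <= L) -> (forall i, `|X i| <= L) ->
  orbit L x X -> exists (s : 'S_3) (w : {ffun 'I_3 -> 'I_5}),
    forall i, x i = X (s i) + L * ((w i : nat)%:Z - 2)%:~R.
Proof.
move=> xb Xb [s [v sP]].
have vb i : (-2 <= v i <= 2)%R.
  have := xb i; have := Xb (s i); rewrite !ler_norml => /andP[a b] /andP[c d].
  have := sP i => E; apply/andP; split.
    rewrite -(ler_int R) -(ler_pM2l L0) mulrNz; lra.
  rewrite -(ler_int R) -(ler_pM2l L0); lra.
have wP i : (`|(v i + 2)%R| < 5)%N.
  by have /andP[] := vb i; clear; lia.
exists s, [ffun i => Ordinal (wP i)] => i.
rewrite ffunE /= gez0_abs ?addrK //.
by have /andP[] := vb i; clear; lia.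
Qed.

Lemma alcove_norm X i : in_alcove L X -> `|X i| <= L.
Proof.
by move=> [x01 x12 x20 xs]; rewrite ler_norml; case: (ord3P i) => ->;
  apply/andP; split; lra.
Qed.

End AlcoveCoordinates.

Lemma torus_point_norm (R : realType) (N : nat) (x : label 3 N) (z : 'rV[R]_4) i :
  (0 < N)%N -> balanced_signs x -> polytope x z -> `|torus_point x z i| <= period R N.
Proof.
move=> N0 xb zP; have [_ _ _ bt _] := tcoord_card xb zP.
have /andP[l r] := bt i; rewrite /torus_point /period epsE ler_norml.
have : (tau x i)%:~R + 1 <= N%:R :> R.
  by rewrite /tau -pmulrn natr1 ler_nat ltn_ord.
have : 0 <= (tau x i)%:~R :> R by rewrite ler0z.
by move=> a b; case: (x.1.1 i); apply/andP; split; rewrite ?expr1 ?expr0; lra.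
Qed.

(** * Piecewise linear maps *)

Local Open Scope classical_set_scope.

Section PiecewiseLinear.
Variable R : realType.

Definition affine_form d (h : 'rV[R]_d -> R) :=
  exists (a : 'cV[R]_d) (b : R), forall z, h z = (z *m a) 0 0 + b.

Definition affine_map d e (h : 'rV[R]_d -> 'rV[R]_e) :=
  exists (M : 'M[R]_(d, e)) (v : 'rV[R]_e), forall z, h z = z *m M + v.

Lemma affine_form_const d (b : R) : affine_form (fun _ : 'rV[R]_d => b).
Proof. by exists 0, b => z; rewrite mulmx0 mxE add0r. Qed.

Lemma affine_form_coord d (i : 'I_d) : affine_form (fun z : 'rV[R]_d => z 0 i).
Proof.
exists (delta_mx i 0), 0 => z; rewrite addr0 mxE (bigD1 i) //= big1 => [|j ji].
  by rewrite mxE !eqxx mulr1 addr0.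
by rewrite mxE (negbTE ji) andFb mulr0.
Qed.

Lemma affine_formD d (h k : 'rV[R]_d -> R) :
  affine_form h -> affine_form k -> affine_form (fun z => h z + k z).
Proof.
move=> [a [b hE]] [a' [b' kE]]; exists (a + a'), (b + b') => z.
by rewrite hE kE mulmxDr [X in _ = X + _]mxE addrACA.
Qed.

Lemma affine_formZ d (r : R) (h : 'rV[R]_d -> R) :
  affine_form h -> affine_form (fun z => r * h z).
Proof.
move=> [a [b hE]]; exists (r *: a), (r * b) => z.
by rewrite hE -scalemxAr [X in _ = X + _]mxE mulrDr.
Qed.

Lemma affine_formN d (h : 'rV[R]_d -> R) :
  affine_form h -> affine_form (fun z => - h z).
Proof.
move=> /(affine_formZ (-1)) [a [b hE]]; exists a, b => z.
by rewrite -hE mulN1r.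
Qed.

Lemma affine_formZr d (r : R) (h : 'rV[R]_d -> R) :
  affine_form h -> affine_form (fun z => h z * r).
Proof.
move=> /(affine_formZ r) [a [b hE]]; exists a, b => z.
by rewrite -hE mulrC.
Qed.

Lemma affine_mapP d e (h : 'rV[R]_d -> 'rV[R]_e) :
  (forall j, affine_form (fun z => h z 0 j)) -> affine_map h.
Proof.
move=> /choice[a /choice[b hE]].
exists (\matrix_(i, j) a j i 0), (\row_j b j) => z.
apply/rowP => j; rewrite hE !mxE; congr (_ + _).
by apply: eq_bigr => i _; rewrite mxE.
Qed.

Lemma polyhedron_of_forms d (J : finType) (h : J -> 'rV[R]_d -> R) :
  (forall j, affine_form (h j)) -> polyhedron [set z | forall j, 0 <= h j z].
Proof.
move=> /choice[a /choice[b hE]].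
exists #|J|, (\matrix_(i, j) - a (enum_val j) i 0), (\row_j b (enum_val j)).
have E z j : (z *m (\matrix_(i, j) - a (enum_val j) i 0)) 0 j
    = - (z *m a (enum_val j)) 0 0.
  by rewrite !mxE -sumrN; apply: eq_bigr => i _; rewrite mxE mulrN.
apply/seteqP; split=> z /= zh j.
  by rewrite E [leRHS]mxE -subr_ge0 opprK addrC -hE.
have := zh (enum_rank j); rewrite E [leRHS]mxE enum_rankK.
by rewrite -subr_ge0 opprK addrC -hE.
Qed.

(** Piecewise linearity from pieces given as the nonnegativity loci of finitely
    many affine forms, indexed by an arbitrary finite type. *)
Lemma pl_map_pieces (X Y : cellSpace R) (f : X -> Y) :
  (forall c : cell X, exists (T J : finType) (h : T -> J -> 'rV[R]_(ambient X) -> R)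
      (G : T -> 'rV[R]_(ambient X) -> 'rV[R]_(ambient Y)) (c' : T -> cell Y),
    [/\ forall t j, affine_form (h t j), forall t, affine_map (G t),
        forall z, body c z -> exists t, forall j, 0 <= h t j z &
        forall t (z : body c), (forall j, 0 <= h t j (val z)) ->
          exists w : body (c' t), val w = G t (val z) /\ f (chart z) = chart w]) ->
  pl_map f.
Proof.
move=> H c; have [T [J [h [G [c' [hA GA cov fG]]]]]] := H c.
exists #|T|, (fun t => [set z | forall j, 0 <= h (enum_val t) j z]); split.
- by move=> t; exact: polyhedron_of_forms.
- by move=> z /cov[t tz]; exists (enum_rank t) => //= j; rewrite enum_rankK.
- move=> t; have [M [v GE]] := GA (enum_val t).
  by exists (c' (enum_val t)), M, v => z Sz; rewrite -GE; exact: fG.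
Qed.

Lemma affine_form_continuous d (h : 'rV[R]_d -> R) : affine_form h -> continuous h.
Proof.
move=> [a [b hE]].
rewrite (_ : h = fun z => \sum_k z 0 k * a k 0 + b); last first.
  by apply/funext => z; rewrite hE mxE.
have sumC : continuous (fun z : 'rV[R]_d => \sum_k z 0 k * a k 0).
  apply: continuous_big => [|k _ z]; first exact: add_continuous.
  have := @coord_continuous R 1 d 0 k z => H; exact: (cvgM H (cvg_cst _)).
by move=> z; exact: cvgD (sumC z) (cvg_cst _).
Qed.

Lemma affine_map_continuous d e (h : 'rV[R]_d -> 'rV[R]_e) :
  affine_map h -> continuous h.
Proof.
move=> [M [v hE]] z A [P zP PA].
have fj j : affine_form (fun z => h z 0 j).
  exists (col j M), (v 0 j) => y; rewrite hE !mxE; congr (_ + _).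
  by apply: eq_bigr => i _; rewrite mxE.
have : \forall y \near z, forall j, P 0 j (h y 0 j).
  apply: (@filter_forall _ _ (fun j y => P 0 j (h y 0 j)) _ (nbhs_filter z)) => j.
  by apply: (affine_form_continuous (fj j)); exact: zP.
by apply: filterS => y Py; apply: PA => i j; rewrite (ord1 i).
Qed.

Lemma polyhedron_closed d (S : set 'rV[R]_d) : polyhedron S -> closed S.
Proof.
move=> [m [A [b ->]]].
rewrite (_ : [set _ | _] =
    \bigcap_j ((fun z => (z *m A) 0 j) @^-1` [set r | r <= b 0 j])).
  apply: closed_bigI => j _; apply: preimage_closed; last exact: closed_le.
  move=> z _; apply: affine_form_continuous.
  exists (col j A), 0 => y; rewrite addr0 !mxE.
  by apply: eq_bigr => i _; rewrite mxE.
by apply/seteqP; split=> z /= H j; [move=> _|]; exact: H.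
Qed.

(** Near a point, only the pieces that contain it matter, since there are finitely
    many pieces and they are closed; on each of them f is an affine map followed by
    a chart. *)
Lemma pl_map_continuous (X Y : cellSpace R) (f : X -> Y) :
  (forall c : cell Y, continuous (@chart R Y c)) -> pl_map f ->
  forall c : cell X, continuous (f \o @chart R X c).
Proof.
move=> cY fpl c z0 B fB; have [q [S [Sp cov fS]]] := fpl c.
have val_cont : continuous (val : body c -> 'rV[R]_(ambient X)).
  exact: initial_continuous.
have : \forall z \near z0, forall t, S t (val z) -> B (f (chart z)).
  apply: (@filter_forall _ _ (fun t z => S t (val z) -> B (f (chart z))) _
    (nbhs_filter z0)) => t.
  have [Sz0|Sz0] := pselect (S t (val z0)); last first.
    have : \forall z \near z0, ~ S t (val z).
      apply: (val_cont z0 (~` S t)); apply: open_nbhs_nbhs; split=> //.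
      by apply: closed_openC; exact: polyhedron_closed.
    by apply: (@filterS _ _ (nbhs_filter z0)) => z nSz /nSz.
  have [c' [M [v MP]]] := fS t.
  have [w0 [w0E fw0]] := MP _ Sz0.
  have : nbhs w0 (@chart R Y c' @^-1` B) by apply: cY; rewrite -fw0.
  case=> _ /= [] [W oW <-] /= Ww0 sWB.
  have : \forall z \near z0, W (val z *m M + v).
    have aC : continuous (fun y : 'rV[R]_(ambient X) => y *m M + v).
      by apply: affine_map_continuous; exists M, v.
    apply: (val_cont z0 ((fun y : 'rV[R]_(ambient X) => y *m M + v) @^-1` W)).
    apply: (aC (val z0) W); apply: open_nbhs_nbhs; split=> //.
    by rewrite -w0E.
  apply: (@filterS _ _ (nbhs_filter z0)) => z Wz Sz; have [w [wE ->]] := MP _ Sz.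
  by apply: sWB => /=; rewrite -[set_val w]/(val w) wE.
apply: (@filterS _ _ (nbhs_filter z0)) => z Bz.
by have [t _ Sz] := cov _ (set_valP z); exact: Bz Sz.
Qed.

End PiecewiseLinear.

(** * Points of the complex over points of the simplex *)

Section Gluing.
Variables (R : realType) (N : nat).
Hypothesis N0 : (0 < N)%N.

Local Notation L := (period R N).
Local Notation points := (polytopes R 3 N).
Local Notation X := (dual_complex R 3 N).
Local Notation Y := (standard_simplex R 2).
Implicit Types (p : points) (y : Y).

Lemma deepest_balanced (c : deepest 3 N) : balanced_signs (val c).
Proof. by have := valP c; rewrite /= admissible_setT => /andP[]. Qed.

Lemma coordsP p : polytope (val (projT1 p)) (coords p).
Proof. exact: set_valP. Qed.

Definition torus_of p := torus_point (val (projT1 p)) (coords p).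

(** The relation that descends to the homeomorphism: the point p of a cell and the
    point y of the simplex give the same unordered triple on the circle. *)
Definition over p y := orbit L (torus_of p) (alcove_point L (val y)).

Lemma same_point_orbit p p' : same_point p p' <-> orbit L (torus_of p) (torus_of p').
Proof.
have [b b'] := (deepest_balanced (projT1 p), deepest_balanced (projT1 p')).
rewrite /same_point /torus_of; have zP := coordsP p; have zP' := coordsP p'.
split=> [/andP[/eqP E /eqP M]|O].
  by rewrite -E in zP' *; apply/same_mtuple_orbit.
have E := orbit_coords b b' zP zP' O; rewrite -E in zP' O.
by rewrite E eqxx /= -E; apply/eqP/(same_mtuple_orbit N0 b b' zP zP').
Qed.

Lemma over_point y : exists p, over p y.
Proof.
have [_ _ _ s0] := alcove_pointP (period_gt0 R N0) (set_valP y).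
have [x [z [xa zP O]]] := label_exists N0 s0.
pose c : deepest 3 N := exist _ x xa.
by exists (existT _ c (SigSub (mem_set zP))).
Qed.

Lemma torus_of_sum p : torus_of p p0 + torus_of p p1 + torus_of p p2 =
  2 * ((\sum_i tau (val (projT1 p)) i) + kk (val (projT1 p)))%:~R.
Proof.
have [_] := (polytopeP _ (deepest_balanced (projT1 p))).1 (coordsP p).
by rewrite !sum3 !intrD /torus_of /torus_point; lra.
Qed.

(** The sum of the x_i is 2 (tau_1 + tau_2 + tau_3 + k), a multiple of 2 N by
    admissibility, so the orbit meets the alcove. *)
Lemma over_simplex p : exists y, over p y.
Proof.
have : exists m : int, torus_of p p0 + torus_of p p1 + torus_of p p2 = L * m%:~R.
  have := valP (projT1 p); rewrite /= admissible_setT => /andP[/dvdzP[m mE] _].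
  by exists m; rewrite torus_of_sum mE intrM /period -pmulrn; ring.
move=> [m mE]; have [A [AO AP]] := alcove_exists (period_gt0 R N0) mE.
have yP : simplex_set (gaps L A).
  by apply: gaps_simplex; [exact: period_gt0 | exact/gaps_ge0/AP/period_gt0].
exists (SigSub (mem_set yP)).
have [_ _ _ A0] := AP.
have [s [v sP]] := AO; exists s, v => i.
by rewrite sP gapsK //; exact: period_gt0.
Qed.

Lemma over_uniq p y y' : over p y -> over p y' -> y = y'.
Proof.
move=> O O'; apply: val_inj.
have L0 := period_gt0 R N0.
rewrite -(alcove_pointK L0 (set_valP y)) -(alcove_pointK L0 (set_valP y')).
have E : forall i, alcove_point L (val y) i = alcove_point L (val y') i.
  apply: (alcove_uniq L0); [exact: alcove_pointP (set_valP y)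
    |exact: alcove_pointP (set_valP y')|].
  exact: orbit_trans (orbit_sym O) O'.
by apply/rowP => i; rewrite !mxE !E.
Qed.

Lemma pi_orbit p p' : \pi_({eq_quot @same_point R 3 N}) p = \pi p' <->
  orbit L (torus_of p) (torus_of p').
Proof. by rewrite -same_point_orbit; split=> /eqmodP. Qed.

Lemma repr_orbit p :
  orbit L (torus_of (generic_quotient.repr (\pi_({eq_quot @same_point R 3 N}) p)))
    (torus_of p).
Proof. by apply/pi_orbit; rewrite reprK. Qed.
End Gluing.

(** * The homeomorphism *)

Section AffineForms.
Variable R : realType.

Lemma affine_form_eq d (h k : 'rV[R]_d -> R) :
  (forall z, h z = k z) -> affine_form k -> affine_form h.
Proof. by move=> hk [a [b kE]]; exists a, b => z; rewrite hk. Qed.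

Lemma affine_form_sum d (I : Type) (r : seq I) (P : pred I) (h : I -> 'rV[R]_d -> R) :
  (forall i, affine_form (h i)) -> affine_form (fun z => \sum_(i <- r | P i) h i z).
Proof.
move=> hA; elim: r => [|i r IH].
  by apply: affine_form_eq (affine_form_const d 0) => z; rewrite big_nil.
have [Pi|Pi] := boolP (P i).
  by apply: affine_form_eq (affine_formD (hA i) IH) => z; rewrite big_cons Pi.
by apply: affine_form_eq IH => z; rewrite big_cons (negbTE Pi).
Qed.

Ltac affine := repeat first
  [ exact: affine_form_const | exact: affine_form_coord | assumption
  | match goal with H : forall i, affine_form _ |- _ => exact: H end
  | apply: affine_formD | apply: affine_formN | apply: affine_formZ
  | apply: affine_formZr | apply: affine_form_sum => ? ].

Lemma gaps_affine d (L : R) (A : 'rV[R]_d -> 'I_3 -> R) :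
  (forall i, affine_form (fun z => A z i)) ->
  forall j, affine_form (fun z => gaps L (A z) 0 j).
Proof.
move=> hA j; case: (ord3P j) => ->;
  [pose k z := (A z p0 - A z p1) / L | pose k z := (A z p1 - A z p2) / L
  |pose k z := (A z p2 - A z p0) / L + 1];
  apply: (@affine_form_eq _ _ k) => [z|]; rewrite ?mxE // /k; affine.
Qed.

Lemma zcoord_affine d (t : 'rV[R]_d -> 'I_3 -> R) :
  (forall i, affine_form (fun z => t z i)) ->
  forall j, affine_form (fun z => zcoord (t z) 0 j).
Proof.
move=> hA j; case: (ord4P j) => ->;
  [pose k z := t z p0 - (t z p0 + t z p1 - t z p2) / 4 | pose k z := t z p1 - t z p0
  |pose k z := t z p2 - t z p1
  |pose k z := 1 - t z p2 + (t z p0 + t z p1 - t z p2) / 4];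
  apply: (@affine_form_eq _ _ k) => [z|]; rewrite ?mxE // /k; affine.
Qed.

Lemma alcove_point_affine (L : R) i : affine_form (fun y => alcove_point L y i).
Proof.
rewrite /alcove_point; apply: affine_formZ.
by case: (ord3P i) => -> /=; affine.
Qed.

Lemma torus_point_affine N (x : label 3 N) i :
  affine_form (fun z : 'rV[R]_4 => torus_point x z i).
Proof. by rewrite /torus_point /tcoord; affine. Qed.

Lemma eps_sqr N (x : label 3 N) i : (eps x i)%:~R * (eps x i)%:~R = 1 :> R.
Proof. by rewrite epsE -expr2 sqrr_sign. Qed.

End AffineForms.

Section Homeomorphism.
Variables (R : realType) (N : nat).
Hypothesis N0 : (0 < N)%N.

Local Notation L := (period R N).
Local Notation X := (dual_complex R 3 N).
Local Notation Y := (standard_simplex R 2).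
Local Notation glue := \pi_({eq_quot @same_point R 3 N}).

Definition shift (w : {ffun 'I_3 -> 'I_5}) i : R := L * ((w i : nat)%:Z - 2)%:~R.

(** On a fixed cell there is one piece for each permutation and bounded shift: the
    set where they move the triple into the alcove. Zero sum is imposed by the two
    opposite inequalities indexed by a boolean. *)
Lemma pl_to_simplex (f : X -> Y) :
  (forall p, over p (f (glue p))) -> pl_map f.
Proof.
move=> fP; have L0 := period_gt0 R N0.
apply: pl_map_pieces => c.
pose T := ('S_3 * {ffun 'I_3 -> 'I_5})%type.
pose A (t : T) (z : 'rV[R]_4) i := torus_point (val c) z (t.1 i) + shift t.2 i.
have Aaff t i : affine_form (fun z => A t z i).
  by apply: affine_formD; [exact: torus_point_affine | exact: affine_form_const].
have Gaff t j : affine_form (fun z => gaps L (A t z) 0 j).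
  by apply: gaps_affine => i; exact: Aaff.
pose h (t : T) (j : 'I_3 + bool) (z : 'rV[R]_4) := match j with
  | inl i => gaps L (A t z) 0 i
  | inr b => (-1) ^+ b * \sum_i A t z i
  end.
exists T, ('I_3 + bool)%type, h, (fun t z => gaps L (A t z)), (fun=> tt).
split.
- move=> t [i|b]; first exact: Gaff.
  by apply: affine_formZ; apply: affine_form_sum => i; exact: Aaff.
- by move=> t; apply: affine_mapP; exact: Gaff.
- move=> z zP; pose p : polytopes R 3 N :=
    existT (fun c => polytope_space R c) c (SigSub (mem_set zP)).
  have [y py] := over_simplex N0 p.
  have AP := alcove_pointP L0 (set_valP y).
  have [s [w sw]] : exists s w, forall i, alcove_point L (val y) i = A (s, w) z i.
    apply: (orbit_bounded L0 _ _ (orbit_sym py)) => i; first exact: alcove_norm.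
    exact: torus_point_norm N0 (deepest_balanced c) zP.
  exists (s, w) => j; rewrite /h.
  have <- : alcove_point L (val y) = A (s, w) z by apply/funext.
  case: j => [i|b]; first exact: gaps_ge0.
  by have [_ _ _ S0] := AP; rewrite sum3 S0 mulr0.
- move=> t z zh; have gP : simplex_set (gaps L (A t (val z))).
    by apply: gaps_simplex => // i; exact: (zh (inl i)).
  exists (SigSub (mem_set gP)); split=> //=.
  apply: (over_uniq N0 (fP (existT _ c z))).
  apply: orbit_sym; exists t.1, (fun i => (t.2 i : nat)%:Z - 2) => i.
  rewrite gapsK // -sum3; apply/le_anti/andP; split.
    by have := zh (inr true); rewrite /h expr1 mulN1r oppr_ge0.
  by have := zh (inr false); rewrite /h expr0 mul1r.
Qed.

(** One piece for each label, permutation and bounded shift: the set of y whose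
    translate yields nonnegative coordinates z that satisfy the balance condition
    of the label. Since k takes only the values -1, 0 and 1, it is encoded in 'I_3. *)
Lemma pl_from_simplex (g : Y -> X) :
  (forall p y, over p y -> g y = glue p) -> pl_map g.
Proof.
move=> gP; have L0 := period_gt0 R N0.
apply: pl_map_pieces => -[].
pose code := ({ffun 'I_3 -> bool} * {ffun 'I_3 -> 'I_N} * 'I_3)%type.
pose decode (u : code) : label 3 N := (u.1, (u.2 : nat)%:Z - 1).
pose T := {u : code * 'S_3 * {ffun 'I_3 -> 'I_5} |
  admissible [set: 'I_4]%SET (decode u.1.1)}.
pose lab (t : T) : label 3 N := decode (val t).1.1.
pose A (t : T) (y : 'rV[R]_3) i := (eps (lab t) i)%:~R *
  (alcove_point L y ((val t).1.2 i) + shift (val t).2 i - 2 * (tau (lab t) i)%:~R).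
have Aaff t i : affine_form (fun y => A t y i).
  apply: affine_formZ; apply: affine_formD; last exact: affine_form_const.
  by apply: affine_formD; [exact: alcove_point_affine | exact: affine_form_const].
have Gaff t j : affine_form (fun y => zcoord (A t y) 0 j).
  by apply: zcoord_affine => i; exact: Aaff.
pose bal (t : T) y := \sum_i (eps (lab t) i)%:~R * A t y i - 2 * (kk (lab t))%:~R.
pose h (t : T) (j : 'I_4 + bool) (y : 'rV[R]_3) := match j with
  | inl i => zcoord (A t y) 0 i
  | inr b => (-1) ^+ b * bal t y
  end.
pose c (t : T) : deepest 3 N := exist _ (lab t) (valP t).
exists T, ('I_4 + bool)%type, h, (fun t y => zcoord (A t y)), c.
split.
- move=> t [i|b]; first exact: Gaff.
  apply: affine_formZ; apply: affine_formD; last exact: affine_form_const.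
  by apply: affine_form_sum => i; apply: affine_formZ; exact: Aaff.
- by move=> t; apply: affine_mapP; exact: Gaff.
- move=> y0 yP; pose y : Y := SigSub (mem_set yP).
  have [p py] := over_point N0 y.
  pose x := val (projT1 p); pose z := coords p.
  have xb : balanced_signs x := deepest_balanced _.
  have zP : polytope x z := coordsP p.
  have AP := alcove_pointP L0 yP.
  have [s [w sw]] : exists (s : 'S_3) (w : {ffun 'I_3 -> 'I_5}), forall i,
      torus_point x z i = alcove_point L y0 (s i) + shift w i.
    have xL i : `|torus_of p i| <= L := torus_point_norm i N0 xb zP.
    by have [s [w sw]] := orbit_bounded L0 xL (fun i => alcove_norm i AP) py; exists s, w.
  have [k kE] : exists k : 'I_3, kk x = (k : nat)%:Z - 1.
    by case: (balanced_signsP xb) => -[-> _];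
      [exists p2 | exists p0 | exists p1 | exists p1].
  have xE : decode (x.1, k) = x.
    by rewrite /decode /= -kE; case: (x) => [[? ?] ?].
  have xa : admissible [set: 'I_4]%SET (decode (x.1, k)).
    by rewrite xE; exact: (valP (projT1 p)).
  pose t : T := exist _ (x.1, k, s, w) xa.
  have lE : lab t = x := xE.
  have tE : A t y0 = tcoord z.
    apply/funext => i; rewrite /A lE /= -sw /torus_point addrAC subrr add0r.
    by rewrite mulrA eps_sqr mul1r.
  exists t => -[i|b]; rewrite /h /bal tE.
    by have [zs _] := zP; rewrite tcoordK //; case: zs.
  by rewrite lE; have [_ ->] := (polytopeP z xb).1 zP; rewrite subrr mulr0.
- move=> t y yh.
  have xb : balanced_signs (lab t) := deepest_balanced (c t).
  have zP : polytope (lab t) (zcoord (A t (val y))).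
    apply: zcoord_polytope => //; first by move=> i; exact: (yh (inl i)).
    apply/eqP; rewrite -subr_eq0; apply/eqP/le_anti/andP; split.
      by have := yh (inr true); rewrite /h expr1 mulN1r oppr_ge0.
    by have := yh (inr false); rewrite /h expr0 mul1r.
  exists (SigSub (mem_set zP)); split=> //=.
  apply: gP; exists (val t).1.2, (fun i => ((val t).2 i : nat)%:Z - 2) => i.
  rewrite /torus_of /= /torus_point zcoordK /A mulrA eps_sqr mul1r /shift.
  by rewrite addrC subrK.
Qed.

Lemma dual_complex_homeo : pl_homeomorphic X Y.
Proof.
pose rep (q : X) := generic_quotient.repr (q : {eq_quot @same_point R 3 N}).
have [f fP] := choice (fun q : X => over_simplex N0 (rep q)).
have [b bP] := choice (over_point (R := R) N0).
pose g y : X := glue (b y).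
have fover p : over p (f (glue p)).
  exact: orbit_trans (orbit_sym (repr_orbit N0 p)) (fP _).
have gover p y : over p y -> g y = glue p.
  by move=> py; apply/(pi_orbit N0); exact: orbit_trans (bP y) (orbit_sym py).
have fpl : pl_map f := pl_to_simplex fover.
have gpl : pl_map g := pl_from_simplex gover.
exists f, g; do !split=> //.
- by move=> q; rewrite (gover (rep q)) ?/rep ?reprK.
- by move=> y; apply: (over_uniq N0 (fover (b y))); exact: bP.
- apply/quotient_continuous => -[c z].
  have : continuous (f \o @chart R X c) by apply: (pl_map_continuous _ fpl) => ? ? ?.
  by move=> /(_ z).
- have chartC (c : cell X) : continuous (@chart R X c).
    move=> z B zB.
    apply: (@existT_continuous _ (fun c => polytope_space R c) c z
      (fun p => B (glue p))).
    exact: pi_continuous zB.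
  by move=> y; exact: (@pl_map_continuous _ _ _ _ chartC gpl tt y).
Qed.

End Homeomorphism.

(** * Dimension *)

Section Dimension.
Variables (R : realType) (N : nat).
Hypothesis N0 : (0 < N)%N.

Lemma polytope_equation (x : label 3 N) : balanced_signs x ->
  exists b : R, forall z : 'rV[R]_4, polytope x z -> z 0 q0 = z 0 q2 + b * z 0 q3.
Proof.
move=> xb; case: (balanced_signsP xb) => -[kE [e0 e1 e2]];
  [exists 1 | exists 1 | exists 0 | exists 0] => z zP;
  have [/simplex4P[_ _ _ _ zs]] := (polytopeP z xb).1 zP;
  rewrite sum3 kE e0 e1 e2; have [-> -> ->] := tcoordE z;
  rewrite ?mulrNz ?mulr1z ?mulr0z => E; lra.
Qed.

(** Differences of points of the cell are killed by two independent linear forms, so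
    at most two of them are independent. *)
Lemma polytope_dim_lt3 (x : label 3 N) : balanced_signs x ->
  ~ dim_ge (polytope (R := R) x) 3.
Proof.
move=> xb [p [pP free]]; have [b bP] := polytope_equation xb.
(* The columns of C are the linear forms of the two equations of the cell, and the
   left inverse D shows that they are independent. *)
pose C : 'M[R]_(4, 2) := \matrix_(a, j) (if j == 0 then 1 else
  nth 0 [:: 1; 0; -1; - b] a).
pose D : 'M[R]_(2, 4) := \matrix_(i, a) (if i == 0 then (a == q1)%:R else
  (a == q0)%:R - (a == q1)%:R).
have DC : D *m C = 1%:M.
  apply/matrixP => i j; rewrite !mxE sum4 !mxE /=.
  by case: i => [[|[|]]] // ?; case: j => [[|[|]]] // ?; rewrite /=; ring.
have C2 : (2 <= \rank C)%N by have := mxrankM_maxr D C; rewrite DC mxrank1.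
set M := \matrix_(i < 3) _ in free.
have MC : M *m C = 0.
  apply/matrixP => i j; rewrite !mxE sum4 !mxE /=.
  have [/simplex4P[_ _ _ _ s1] _] := pP (fintype.lift ord0 i).
  have [/simplex4P[_ _ _ _ s0] _] := pP ord0.
  have := bP _ (pP (fintype.lift ord0 i)); have := bP _ (pP ord0).
  by case: j => [[|[|]]] // ? /= E0 E1; lra.
have := mulmx0_rank_max MC; move: free; rewrite -row_leq_rank => free.
by rewrite leqNgt (leq_trans _ (leq_add free C2)).
Qed.

(** The cell with signs (-, -, +), tau = 0 and k = 0 is the triangle with vertices
    e_4, e_2 and (e_1 + e_3) / 2. *)
Lemma dim2_witness : exists c : deepest 3 N, dim_ge (polytope (R := R) (val c)) 2.
Proof.
pose x : label 3 N := ([ffun i => i != p2], [ffun=> Ordinal N0], 0).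
have xb : balanced_signs x by rewrite /balanced_signs /kk /= !ffunE.
have xa : admissible [set: 'I_4]%SET x.
  rewrite admissible_setT xb andbT addr0 big1 ?dvdz0 // => i _.
  by rewrite /tau ffunE.
exists (exist _ x xa).
pose v (a b c d : R) : 'rV[R]_4 := \row_i nth 0 [:: a; b; c; d] i.
have vP a b d : 0 <= a -> 0 <= b -> 0 <= d -> a + b + a + d = 1 -> polytope x (v a b a d).
  move=> a0 b0 d0 s; apply/(polytopeP _ xb); split.
    by apply/simplex4P; rewrite !mxE.
  rewrite sum3 !epsE !ffunE /kk /=; have [-> -> ->] := tcoordE (v a b a d).
  by rewrite !mxE /= expr1 expr0; lra.
pose p (i : 'I_3) := nth 0 [:: v 0 0 0 1; v 0 1 0 0; v 2^-1 0 2^-1 0] i.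
exists p; split=> [i|].
  by case: (ord3P i) => -> /=; apply: vP; lra.
apply/row_freeP; exists (\matrix_(a < 4, j < 2)
  (if j == 0 then (a == q1)%:R else 2 * (a == q0)%:R)).
apply/matrixP => i j; rewrite !mxE sum4 !mxE /=.
by case: i => [[|[|]]] // ?; case: j => [[|[|]]] // ?; rewrite /= !mxE /=; lra.
Qed.

Lemma dual_complex_dimension : cell_dimension (dual_complex R 3 N) 2.
Proof.
by split=> [|c]; [exact: dim2_witness | exact: polytope_dim_lt3 (deepest_balanced c)].
Qed.

End Dimension.

Theorem theorem1p3 (R : realType) (N : nat) (hN : (0 < N)%N) :
  pl_homeomorphic (dual_complex R 3 N) (standard_simplex R 2)
  /\ cell_dimension (dual_complex R 3 N) 2.
Proof. by split; [exact: dual_complex_homeo | exact: dual_complex_dimension]. Qed.
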